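(* Every simple partially ordered abelian group embeds into a simple Riesz group with divisible positive cone.
   Context: A partially ordered abelian group is an abelian group $G$ with a translation-invariant partial order; its positive cone is $G^+=\{x\in G: x\ge 0\}$. It is directed if every element is a difference of two elements of $G^+$. $G$ is simple if it is directed and every nonzero $u\in G^+$ is an order-unit (every $x\in G$ satisfies $x\le nu$ for some positive integer $n$). An embedding $f:G\to H$ of partially ordered abelian groups is an injective group homomorphism such that $x\ge0\iff f(x)\ge0$. A Riesz group is a directed partially ordered abelian group with the interpolation property: whenever $x_0,x_1\le y_0,y_1$ there is $z$ with $x_0,x_1\le z\le y_0,y_1$ (equivalently, the positive cone is a refinement monoid). The positive cone $G^+$ is divisible if for every $a\in G^+$ and every positive integer $m$ there is $x\in G^+$ with $mx=a$. *)

(* Defs.v *)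
From HB Require Import structures.
From mathcomp Require Import all_boot all_order all_algebra.

Set Implicit Arguments.
Unset Strict Implicit.
Unset Printing Implicit Defensive.

Import Order.TTheory GRing.Theory Num.Theory.
Local Open Scope ring_scope.

(* [porderZmodType] is only the join of an abelian group structure and a partial
   order: no axiom relates the two, so translation invariance, which makes it a
   partially ordered abelian group, is stated separately. *)
Definition po_abgroup (G : porderZmodType) : Prop :=
  forall x y z : G, x <= y -> x + z <= y + z.

Definition directed (G : porderZmodType) : Prop :=
  forall x : G, exists a b : G, [/\ 0 <= a, 0 <= b & x = a - b].

Definition order_unit (G : porderZmodType) (u : G) : Prop :=
  forall x : G, exists2 n : nat, (0 < n)%N & x <= u *+ n.

Definition simple_po_abgroup (G : porderZmodType) : Prop :=
  [/\ po_abgroup G, directed G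
    & forall u : G, 0 <= u -> u <> 0 -> order_unit u].

Definition interpolation (G : porderZmodType) : Prop :=
  forall x0 x1 y0 y1 : G,
    x0 <= y0 -> x0 <= y1 -> x1 <= y0 -> x1 <= y1 ->
    exists z : G, [/\ x0 <= z, x1 <= z, z <= y0 & z <= y1].

Definition riesz_group (G : porderZmodType) : Prop :=
  [/\ po_abgroup G, directed G & interpolation G].

Definition divisible_positive_cone (G : porderZmodType) : Prop :=
  forall (a : G) (m : nat), 0 <= a -> (0 < m)%N ->
    exists2 x : G, 0 <= x & x *+ m = a.

Definition po_embedding (G H : porderZmodType) (f : {additive G -> H}) : Prop :=
  injective f /\ forall x : G, 0 <= x <-> 0 <= f x.

(* Main.v *)
(* Fix an order-unit u > 0 of the simple group G.  A "one-type" over G is a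
   submonoid P of G x Z, read as the set of all g + n z declared nonnegative for
   a new element z, which meets G in the positive cone of G.  All one-types over
   G are realized at once in G + Z^(one-types): the cones P_i combine into a
   cone C that still meets G in its positive cone.  Simplicity is then restored
   by keeping as positive only 0 and those v in C having a multiple above u.

   Interpolants of x0, x1 < y0, y1 are realized by the one-type generated by
   z - x_i >= 0, y_j - z >= 0, N (z - x_i) >= u and N (y_j - z) >= u, where N is
   large enough that this adds nothing to the positive cone of G.  Quotients a/m
   are realized by a similar one-type.  Iterating omega times and taking the
   colimit yields the Riesz group. *)

Require Import Defs.
From HB Require Import structures.
From mathcomp Require Import all_boot all_order all_algebra finmap zify.
From mathcomp Require Import boolp functions.

Set Implicit Arguments.
Unset Strict Implicit.
Unset Printing Implicit Defensive.

Import Order.TTheory GRing.Theory Num.Theory.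
Local Open Scope ring_scope.

(* [cone] need not be contained in the subgroup [dom]: only its trace on [dom]
   matters. *)
Record precone (V : zmodType) := Precone {
  dom : V -> Prop;
  cone : V -> Prop;
  dom0 : dom 0;
  domB : forall x y, dom x -> dom y -> dom (x - y);
  cone0 : cone 0;
  coneD : forall x y, cone x -> cone y -> cone (x + y) }.

(** * The partially ordered quotient of a precone *)

Section PreconeQuotient.
Variables (V : zmodType) (K : precone V).

Lemma domN x : dom K x -> dom K (- x).
Proof. by move=> Kx; rewrite -sub0r; apply: domB => //; apply: dom0. Qed.

Lemma domD x y : dom K x -> dom K y -> dom K (x + y).
Proof. by move=> Kx Ky; rewrite -[y]opprK; apply: domB => //; apply: domN. Qed.

(** Only [dom K y] is included: [x] is the element being represented, and this clause keeps the
    chosen representative in the subgroup. *)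
Definition cone_equiv x y := [/\ dom K y, cone K (x - y) & cone K (y - x)].

Definition cone_repr x := choose (fun y => `[< cone_equiv x y >]) x.

Lemma cone_equiv_refl x : dom K x -> cone_equiv x x.
Proof. by split; rewrite ?subrr //; apply: cone0. Qed.

Lemma cone_reprP x : dom K x -> cone_equiv x (cone_repr x).
Proof.
move=> Kx; apply/asboolP.
by apply: (@chooseP _ (fun y => `[< cone_equiv x y >])); apply/asboolP/cone_equiv_refl.
Qed.

Lemma cone_equivS x y z : dom K x -> cone_equiv x y -> cone_equiv x z -> cone_equiv y z.
Proof.
move=> Kx [Ky xy yx] [Kz xz zx]; split=> //.
  by rewrite -(subrKA x); apply: coneD.
by rewrite -(subrKA x); apply: coneD.
Qed.

(** Equivalent elements define the same predicate, and [choose] depends only on the predicate as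
    long as its default satisfies it. *)
Lemma eq_cone_repr x y : dom K x -> cone_equiv x y -> cone_repr x = cone_repr y.
Proof.
move=> Kx xy; have [Ky Cxy Cyx] := xy.
have Px : `[< cone_equiv x x >] by apply/asboolP/cone_equiv_refl.
have Py : `[< cone_equiv x y >] by apply/asboolP.
rewrite /cone_repr (choose_id (P := fun z => `[< cone_equiv x z >]) Px Py).
apply: eq_choose => z; apply/asboolP/asboolP => h.
  exact: (cone_equivS Kx).
by apply: (cone_equivS Ky) h; split.
Qed.

Definition is_cone_repr x := `[< dom K x /\ cone_repr x = x >].

Definition cone_quot := {x : V | is_cone_repr x}.
HB.instance Definition _ := Choice.on cone_quot.

Lemma cone_repr_in x : dom K x -> is_cone_repr (cone_repr x).
Proof.
move=> Kx; have xr := cone_reprP Kx; have [Kr _ _] := xr.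
by apply/asboolP; split=> //; rewrite -(eq_cone_repr Kx xr).
Qed.

(** Elements outside [dom] receive the class of 0 as default; additivity is claimed on [dom]
    alone. *)
Definition cone_pi (x : V) : cone_quot :=
  insubd (exist is_cone_repr _ (cone_repr_in (dom0 K))) (cone_repr x).

Lemma val_cone_pi x : dom K x -> val (cone_pi x) = cone_repr x.
Proof. by move=> Kx; rewrite val_insubd cone_repr_in. Qed.

Lemma dom_val (a : cone_quot) : dom K (val a).
Proof. by have /asboolP[] := valP a. Qed.
Hint Resolve dom_val : core.

Lemma cone_piK a : cone_pi (val a) = a.
Proof. by apply: val_inj; rewrite val_cone_pi //; have /asboolP[] := valP a. Qed.

Lemma cone_equiv_val x : dom K x -> cone_equiv x (val (cone_pi x)).
Proof. by move=> Kx; rewrite val_cone_pi //; apply: cone_reprP. Qed.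

Lemma eq_cone_pi x y : dom K x -> cone_equiv x y -> cone_pi x = cone_pi y.
Proof.
move=> Kx xy; apply: val_inj; have [Ky _ _] := xy.
by rewrite !val_cone_pi // (eq_cone_repr Kx xy).
Qed.

Definition quot_add (a b : cone_quot) := cone_pi (val a + val b).
Definition quot_opp (a : cone_quot) := cone_pi (- val a).

Lemma quot_addE x y : dom K x -> dom K y ->
  quot_add (cone_pi x) (cone_pi y) = cone_pi (x + y).
Proof.
move=> Kx Ky; apply/esym/eq_cone_pi; first exact: domD.
have [? ? ?] := cone_equiv_val Kx; have [? ? ?] := cone_equiv_val Ky.
by split; rewrite ?opprD 1?addrACA; [apply: domD | apply: coneD..].
Qed.

Lemma quot_oppE x : dom K x -> quot_opp (cone_pi x) = cone_pi (- x).
Proof.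
move=> Kx; apply/esym/eq_cone_pi; first exact: domN.
have [? ? ?] := cone_equiv_val Kx.
by split; rewrite ?opprK 1?addrC //; apply: domN.
Qed.

Lemma quot_addA : associative quot_add.
Proof.
move=> a b c; rewrite -[a]cone_piK -[b]cone_piK -[c]cone_piK.
by rewrite !quot_addE ?addrA //; apply: domD.
Qed.

Lemma quot_addC : commutative quot_add.
Proof. by move=> a b; rewrite /quot_add addrC. Qed.

Lemma quot_add0 : left_id (cone_pi 0) quot_add.
Proof.
by move=> a; rewrite -{1}[a]cone_piK quot_addE ?add0r ?cone_piK //; apply: dom0.
Qed.

Lemma quot_addN : left_inverse (cone_pi 0) quot_opp quot_add.
Proof.
move=> a; rewrite -[a]cone_piK quot_oppE // quot_addE ?addNr //.
exact: domN.
Qed.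

HB.instance Definition _ :=
  GRing.isZmodule.Build cone_quot quot_addA quot_addC quot_add0 quot_addN.

Definition quot_le (a b : cone_quot) := `[< cone K (val b - val a) >].

Lemma quot_le_refl : reflexive quot_le.
Proof. by move=> a; apply/asboolP; rewrite subrr; apply: cone0. Qed.

Lemma quot_le_anti : antisymmetric quot_le.
Proof.
move=> a b /andP[/asboolP ab /asboolP ba].
by rewrite -[a]cone_piK -[b]cone_piK; apply: eq_cone_pi.
Qed.

Lemma quot_le_trans : transitive quot_le.
Proof.
move=> b a c /asboolP ab /asboolP bc; apply/asboolP.
by rewrite -(subrKA (val b)); apply: coneD.
Qed.

HB.instance Definition _ := Order.Le_isPOrder.Build ring_display cone_quot
  quot_le_refl quot_le_anti quot_le_trans.


Lemma cone_piB x y : dom K x -> dom K y ->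
  cone_pi (x - y) = cone_pi x - cone_pi y.
Proof.
move=> Kx Ky; rewrite -quot_addE //; last exact: domN.
by rewrite -quot_oppE.
Qed.

Lemma cone_pi_le x y : dom K x -> dom K y ->
  (cone_pi x <= cone_pi y) <-> cone K (y - x).
Proof.
move=> Kx Ky; have [_ xx' x'x] := cone_equiv_val Kx.
have [_ yy' y'y] := cone_equiv_val Ky.
split=> [/asboolP | ] h; last apply/asboolP.
  have -> : y - x = (y - val (cone_pi y)) + (val (cone_pi y) - val (cone_pi x))
                    + (val (cone_pi x) - x) by rewrite !subrKA.
  by apply: coneD => //; apply: coneD.
have -> : val (cone_pi y) - val (cone_pi x) = (val (cone_pi y) - y) + (y - x)
                                              + (x - val (cone_pi x)) by rewrite !subrKA.
by apply: coneD => //; apply: coneD.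
Qed.

Lemma cone_quot_po : po_abgroup cone_quot.
Proof.
move=> a b c /asboolP ab.
apply/(@cone_pi_le (val a + val c) (val b + val c)); try exact: domD.
by rewrite opprD addrACA subrr addr0.
Qed.

End PreconeQuotient.

(** * Simple quotients *)

Lemma subgroup_additiveM (V W : zmodType) (S : V -> Prop) (p : V -> W) :
    S 0 -> (forall x y, S x -> S y -> S (x - y)) ->
    (forall x y, S x -> S y -> p (x - y) = p x - p y) ->
  forall x, S x -> forall n : int, S (x *~ n) /\ p (x *~ n) = p x *~ n.
Proof.
move=> S0 SB pB x Sx.
have p0 : p 0 = 0 by rewrite -[0]subr0 pB // subrr.
have SN y : S y -> S (- y) by move=> Sy; rewrite -sub0r; apply: SB.
have pN y : S y -> p (- y) = - p y by move=> Sy; rewrite -sub0r pB // p0 sub0r.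
have nat_case m : S (x *+ m) /\ p (x *+ m) = p x *+ m.
  elim: m => [|m [Sm IHm]]; first by rewrite !mulr0n.
  rewrite !mulrS -[x *+ m]opprK; split; first by apply: SB => //; apply: SN.
  by rewrite pB ?pN ?opprK ?IHm //; apply: SN.
case=> m; first exact: nat_case.
have [Sm pm] := nat_case m.+1; rewrite NegzE !mulrNz -!pmulrn.
by rewrite -pm; split; [apply: SN | apply: pN].
Qed.

Definition order_bounded (V : zmodType) (C : V -> Prop) (u x : V) :=
  exists k, C (u *+ k - x) /\ C (u *+ k + x).

(* Since [u] will be an order-unit, the elements of [C] admitted as positive are
   the order-units and those that the quotient sends to 0. *)
Definition unit_or_null (V : zmodType) (C : V -> Prop) (u x : V) :=
  C x /\ (C (- x) \/ exists n, C (x *+ n - u)).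

(** Restricting to bounded elements makes [u] an order-unit. A nonzero positive class is represented
    by some [x] with a multiple above [u], so it is an order-unit as well. *)
Lemma simple_quotient (V : zmodType) (C : V -> Prop) (u : V)
    (bounded := order_bounded C u) :
  C 0 -> (forall x y, C x -> C y -> C (x + y)) -> C u -> ~ C (- u) ->
  [/\ bounded 0, forall x y, bounded x -> bounded y -> bounded (x - y)
    & exists (H : porderZmodType) (p : V -> H),
      [/\ simple_po_abgroup H,
          forall x y, bounded x -> bounded y -> p (x - y) = p x - p y
        & forall x, bounded x -> (0 <= p x <-> unit_or_null C u x)]].
Proof.
move=> C0 CD Cu CNu.
have CM x n : C x -> C (x *+ n).
  by move=> Cx; elim: n => [|n IHn]; rewrite ?mulr0n // mulrS; apply: CD.
have bnd0 : bounded 0 by exists 0%N; rewrite subr0 addr0.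
have bndB x y : bounded x -> bounded y -> bounded (x - y).
  move=> [k [kx kx']] [l [ly ly']]; exists (k + l)%N; rewrite mulrnDr; split.
    by rewrite opprB [y - x]addrC addrACA; apply: CD.
  by rewrite addrACA; apply: CD.
pose pos := unit_or_null C u.
have pos0 : pos 0 by split; rewrite ?oppr0 //; left.
have posD x y : pos x -> pos y -> pos (x + y).
  move=> [Cx hx] [Cy hy]; split; first exact: CD.
  case: hx => [CNx|[n hn]]; last first.
    by right; exists n; rewrite mulrnDl addrAC; apply: CD => //; apply: CM.
  case: hy => [CNy|[n hn]]; last first.
    by right; exists n; rewrite mulrnDl -addrA; apply: CD => //; apply: CM.
  by left; rewrite opprD; apply: CD.
pose K := Precone bnd0 bndB pos0 posD.
have bndu k : bounded (u *+ k).
  by exists k; rewrite subrr; split=> //; apply: CD; apply: CM.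
have p0 : cone_pi K 0 = 0 by [].
have p_ge0 x : bounded x -> (0 <= cone_pi K x <-> pos x).
  by move=> bx; rewrite -p0 (cone_pi_le (K := K)) // subr0.
split=> //; exists (cone_quot K), (cone_pi K); split=> //; last exact: (@cone_piB V K).
split=> [|a|a]; first exact: cone_quot_po.
  have [k [k1 k2]] := dom_val a; pose e := u *+ k.+1.
  have be : bounded (val a - - e).
    apply: (bndB); first exact: (@dom_val V K a).
    by rewrite -sub0r; exact: (bndB _ _ bnd0 (bndu k.+1)).
  exists (cone_pi K (val a - - e)), (cone_pi K e); split.
  - apply/p_ge0 => //; rewrite opprK addrC; split; rewrite /e mulrS.
      by rewrite -addrA; apply: CD.
    by right; exists 1%N; rewrite mulr1n [_ - u]addrC !addrA addNr add0r.
  - apply/p_ge0; [exact: bndu|rewrite /e; split; first exact: CM].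
    by right; exists 1%N; rewrite mulr1n mulrS addrAC subrr add0r; apply: CM.
  - rewrite -cone_piB //; last exact: bndu.
    by rewrite opprK addrK cone_piK.
rewrite -[a]cone_piK; move: (val a) (dom_val a) => x bx /p_ge0-/(_ bx)[Cx hx] x0 b.
case: hx => [CNx|[n hn]].
  case: x0; rewrite -p0; apply: eq_cone_pi => //; split=> //=.
    by split; rewrite subr0 //; left.
  by split; rewrite sub0r //; left; rewrite opprK.
have [k [k1 k2]] := dom_val b; rewrite -[b]cone_piK.
move: (val b) (dom_val b) k1 k2 => y bY k1 k2.
have n_gt0 : (0 < n)%N by case: n hn => //; rewrite mulr0n sub0r.
(* Each [x *+ n] exceeds [u]: [k] copies dominate [y], and the remaining one leaves the difference
   above [u]. *)
exists (n * k.+1)%N; first by rewrite muln_gt0 n_gt0.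
have [bm pM] : bounded (x *+ (n * k.+1)) /\
    cone_pi K (x *+ (n * k.+1)) = cone_pi K x *+ (n * k.+1).
  exact: (subgroup_additiveM bnd0 bndB (@cone_piB V K) bx (Posz (n * k.+1))).
rewrite -pM; apply/(cone_pi_le (K := K)) => //=.
have eD : x *+ (n * k.+1) - y = (x *+ n - u) *+ k.+1 + (u *+ k - y) + u.
  rewrite mulrnBl mulrnA [u *+ k.+1]mulrS -!addrA; congr (_ + _).
  by rewrite [- y + u]addrC [_ + (u - y)]addrA [_ + u]addrC addKr.
split; first by rewrite eD; apply: (CD) => //; apply: (CD) => //; apply: CM.
right; exists 1%N; rewrite mulr1n eD addrK; apply: (CD) => //; exact: CM.
Qed.

Definition additive_of (U V : zmodType) (f : U -> V)
    (fB : forall x y, f (x - y) = f x - f y) : {additive U -> V} :=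
  HB.pack f (GRing.isZmodMorphism.Build U V f fB).

(** * Order arithmetic in partially ordered abelian groups *)

Section PoAbgroup.
Variables (G : porderZmodType) (hG : po_abgroup G).
Implicit Types x y z : G.

Lemma po_subr_ge0 x y : 0 <= y - x <-> x <= y.
Proof.
split=> h; first by have := hG x h; rewrite add0r subrK.
by have := hG (- x) h; rewrite subrr.
Qed.

Lemma po_lerD x y z t : x <= y -> z <= t -> x + z <= y + t.
Proof.
move=> xy zt; apply: le_trans (hG z xy) _.
by rewrite ![y + _]addrC; apply: hG.
Qed.

Lemma po_addr_ge0 x y : 0 <= x -> 0 <= y -> 0 <= x + y.
Proof. by move=> x0 y0; rewrite -(addr0 0); apply: po_lerD. Qed.

Lemma po_lerMn2r n x y : x <= y -> x *+ n <= y *+ n.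
Proof. by move=> xy; elim: n => // n IHn; rewrite !mulrS; apply: po_lerD. Qed.

Lemma po_mulrn_ge0 n x : 0 <= x -> 0 <= x *+ n.
Proof. by move=> x0; rewrite -(mul0rn _ n); apply: po_lerMn2r. Qed.

Lemma po_lerMn2l m n x : 0 <= x -> (m <= n)%N -> x *+ m <= x *+ n.
Proof.
move=> x0 mn; apply/po_subr_ge0; rewrite -mulrnBr //; exact: po_mulrn_ge0.
Qed.

Lemma po_oppr_le0 x : 0 <= - x -> x <= 0.
Proof. by move=> x0; apply/po_subr_ge0; rewrite sub0r. Qed.

Lemma po_ge0_anti x : 0 <= x -> 0 <= - x -> x = 0.
Proof. by move=> x0 /po_oppr_le0 x0'; apply/le_anti; rewrite x0 x0'. Qed.

End PoAbgroup.

(* [P g n] reads [0 <= g + n z], with [z] the element to be adjoined. *)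
Record one_type (G : porderZmodType) (u : G) := OneType {
  one_type_rel :> G -> int -> Prop;
  one_typeD : forall g h m n, one_type_rel g m -> one_type_rel h n ->
    one_type_rel (g + h) (m + n);
  one_type0 : forall g, one_type_rel g 0 <-> 0 <= g;
  one_type_lb : exists k, one_type_rel (u *+ k) 1;
  one_type_ub : exists k, one_type_rel (u *+ k) (-1) }.

(** * Simultaneous realization of one-types *)

(** The new element for [P] is the generator of its own coordinate. Relations of [P] with a multiple
    above [u] survive as positivity; those holding in both directions become equations, since the
    quotient kills null elements. *)
Lemma realize_types (G : porderZmodType) (u : G) :
    simple_po_abgroup G -> 0 <= u -> u <> 0 ->
  exists (H : porderZmodType) (f : {additive G -> H}),
    [/\ simple_po_abgroup H, po_embedding f
      & forall P : one_type u, exists z : H,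
        (forall g n, P g n -> (exists N, P (g *+ N - u) (n *+ N)) ->
           0 <= f g + z *~ n) /\
        (forall g n, P g n -> P (- g) (- n) -> f g + z *~ n = 0)].
Proof.
move=> [poG dirG unitG] u_ge0 u_neq0; have unit_u := unitG u u_ge0 u_neq0.
pose I := {classic one_type u}; pose V : zmodType := (G * (I -> int))%type.
(* Only [x] has finite support: [v.2] is unrestricted, as [simple_quotient] keeps
   only the elements bounded by [u]. *)
pose C (v : V) := exists (s : {fset I}) (x : I -> G),
  [/\ forall P : I, (P : one_type u) (x P) (v.2 P), forall P, P \notin s -> x P = 0
    & \sum_(P <- s) x P <= v.1].
(* Over the zero vector every summand satisfies [P (x P) 0], so it is nonnegative in [G]: combining
   one-types adds nothing to the cone of [G]. *)
have C_emb g : C (g, 0) <-> 0 <= g.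
  split=> [[s [x [xP x0 /= le_g]]]|g0]; last first.
    exists fset0, (fun=> 0); split=> //=; last by rewrite big_seq_fset0.
    by move=> P; apply/one_type0.
  apply: le_trans le_g; apply: (big_ind (fun y => 0 <= y)) => //.
    exact: po_addr_ge0.
  by move=> P _; apply/(one_type0 P)/xP.
have CD v w : C v -> C w -> C (v + w).
  move=> [s [x [xP x0 le_v]]] [t [y [yP y0 le_w]]].
  exists (s `|` t)%fset, (fun P => x P + y P); split=> [P|P|] /=.
  - exact: (one_typeD (xP P) (yP P)).
  - by rewrite in_fsetU negb_or => /andP[/x0-> /y0->]; rewrite addr0.
  rewrite big_split /= -(big_fset_incl _ (fsubsetUl s t)); last by move=> P _ /x0.
  rewrite -(big_fset_incl _ (fsubsetUr s t)); last by move=> P _ /y0.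
  exact: po_lerD.
pose gen (P : I) (n : int) : V := (0, fun Q => if Q == P then n else 0).
have genB P m n : gen P (m - n) = gen P m - gen P n.
  congr pair; first by rewrite subr0.
  apply/funext => Q.
  rewrite -[RHS]/((if Q == P then m else 0) - (if Q == P then n else 0)).
  by case: ifP => // _; rewrite subr0.
have genE P n : gen P n = gen P 1 *~ n.
  by rewrite -[LHS]/(additive_of (genB P) n) -[in LHS](intz n) raddfMz.
have C_gen (P : I) g n : (P : one_type u) g n -> C ((g, 0) + gen P n).
  move=> Pgn; exists [fset P]%fset, (fun Q => if Q == P then g else 0); split=> [Q|Q|] /=.
  - rewrite fctE add0r; case: eqP => [->//|_]; exact/one_type0.
  - by rewrite inE => /negbTE->.
  - by rewrite big_seq_fset1 eqxx addr0.
have CNu : ~ C (- (u, 0)).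
  have -> : - (u, 0) = (- u, 0) :> V by congr pair; rewrite oppr0.
  by move=> /C_emb Nu; apply: u_neq0; apply: (po_ge0_anti poG).
have [bnd0 bndB [H [p [simH pB p_ge0]]]] :=
  simple_quotient (proj2 (C_emb 0) (lexx _)) CD (proj2 (C_emb u) u_ge0) CNu.
set bounded := order_bounded C (u, 0) in bnd0 bndB pB p_ge0.
have embMn g n : (g, 0) *+ n = (g *+ n, 0) :> V.
  by elim: n => // n IHn; rewrite !mulrS IHn; congr pair; rewrite addr0.
have embN g : - (g, 0) = (- g, 0) :> V by congr pair; rewrite oppr0.
have embD g h : (g, 0) + (h, 0) = (g + h, 0) :> V by congr pair; rewrite addr0.
have bnd_emb g : bounded (g, 0).
  have [[k _ gk] [l _ gl]] := (unit_u g, unit_u (- g)).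
  exists (k + l)%N; rewrite embMn embN !embD; split; apply/C_emb.
    apply/(po_subr_ge0 poG)/(le_trans gk)/(po_lerMn2l poG) => //.
    exact: leq_addr.
  rewrite -[g in _ + g]opprK; apply/(po_subr_ge0 poG)/(le_trans gl)/(po_lerMn2l poG) => //.
  exact: leq_addl.
(* The bounds [one_type_lb] and [one_type_ub] place the adjoined element between multiples of
   [u]. *)
have bnd_gen P : bounded (gen P 1).
  have [[k Pk] [l Pl]] := (one_type_lb P, one_type_ub P).
  have upward g h n : (P : one_type u) g n -> g <= h -> (P : one_type u) h n.
    move=> Pg /(po_subr_ge0 poG) gh; rewrite -(subrK g h) -(add0r n).
    by apply: one_typeD => //; apply/one_type0.
  exists (k + l)%N; rewrite embMn; split.
    have -> : - gen P 1 = gen P (-1) by rewrite -[-1]sub0r genB (genE P 0) mulr0z sub0r.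
    apply/C_gen/(upward _ _ _ Pl)/(po_lerMn2l poG) => //; exact: leq_addl.
  apply/C_gen/(upward _ _ _ Pk)/(po_lerMn2l poG) => //; exact: leq_addr.
have pM x : bounded x -> forall n : int, bounded (x *~ n) /\ p (x *~ n) = p x *~ n.
  exact: (subgroup_additiveM bnd0 bndB pB).
have [poH _ _] := simH.
have pD x y : bounded x -> bounded y -> p (x + y) = p x + p y.
  move=> bx bY; have [bNy pNy] := pM y bY (-1); rewrite !mulrN1z in bNy pNy.
  by rewrite -[y in LHS]opprK pB // pNy opprK.
have fB g h : p (g - h, 0) = p (g, 0) - p (h, 0).
  by rewrite -pB.
pose f := additive_of fB.
exists H, f; split=> //.
  have f_ge0 g : 0 <= g <-> 0 <= f g.
    split=> [g0|/p_ge0-/(_ (bnd_emb g))[/C_emb//]].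
    apply/p_ge0 => //; split; first exact/C_emb.
    have [->|/eqP g_neq0] := eqVneq g 0; first by left; rewrite embN oppr0; apply/C_emb.
    (* Simplicity of [G] gives every nonzero positive [g] a multiple above [u], so restricting the
       cone loses no positive element of [G]. *)
    have [n _ le_un] := unitG g g0 g_neq0 u.
    by right; exists n; rewrite embMn embN embD; apply/C_emb/(po_subr_ge0 poG).
  split=> // g h fgh; apply/subr0_eq/(po_ge0_anti poG); apply/f_ge0.
    by rewrite raddfB fgh subrr.
  by rewrite opprB raddfB fgh subrr.
move=> P; exists (p (gen P 1)).
have bnd_at g n : bounded ((g, 0) + gen P n).
  rewrite -[gen P n]opprK genE; apply: (bndB) => //.
  by rewrite -mulrNz; have [] := pM _ (bnd_gen P) (- n).
have p_at g n : f g + p (gen P 1) *~ n = p ((g, 0) + gen P n).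
  have [bn pn] := pM _ (bnd_gen P) n.
  by rewrite (genE P n) pD // pn.
have atN g n : - ((g, 0) + gen P n) = (- g, 0) + gen P (- n).
  by rewrite opprD embN; congr (_ + _); rewrite (genE P (- n)) (genE P n) mulrNz.
split=> g n Pgn.
  move=> [N PN]; rewrite p_at; apply/p_ge0 => //; split; first exact: C_gen.
  right; exists N; rewrite mulrnDl embMn addrAC embN embD.
  by rewrite -[gen P n *+ N](raddfMn (additive_of (genB P))); apply: C_gen.
move=> PNgn; apply: (po_ge0_anti poH); rewrite p_at.
  by apply/p_ge0 => //; split; [|left; rewrite atN]; apply: C_gen.
have [bNn pNn] := pM _ (bnd_at g n) (-1); rewrite !mulrN1z in bNn pNn.
by rewrite -pNn; apply/p_ge0 => //; split; [rewrite atN|left; rewrite opprK]; apply: C_gen.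
Qed.

(** * The one-type of a quotient [a/m] *)

Section DivisionType.
Variables (G : porderZmodType) (u a : G) (m : nat).
Hypotheses (poG : po_abgroup G) (a_ge0 : 0 <= a) (m_gt0 : (0 < m)%N).

(* [n = k m + j] splits [g + n z], with [m z = a], as [(g + k a) + j z]. *)
Definition div_rel (g : G) (n : int) :=
  exists (k : int) (j : nat), n = k * m%:Z + j%:Z /\ 0 <= g + a *~ k.

Lemma div_relD g h n n' : div_rel g n -> div_rel h n' -> div_rel (g + h) (n + n').
Proof.
move=> [k [j [-> gk]]] [k' [j' [-> hk]]]; exists (k + k'), (j + j')%N; split; first by lia.
by rewrite mulrzDr addrACA; apply: po_addr_ge0.
Qed.

(** When [n = 0], the equation [k * m = - j] with [m > 0] forces [k <= 0], so [g] is the sum of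
    [g + a *~ k] and a nonnegative multiple of [a]. *)
Lemma div_rel0 g : div_rel g 0 <-> 0 <= g.
Proof.
split=> [[k [j [kj gk]]]|g0]; last by exists 0, 0%N; rewrite mul0r mulr0z !addr0.
have [p kp] : exists p : nat, k = - p%:Z.
  have : k <= 0 by nia.
  by exists `|k|%N; lia.
rewrite -(subrK (a *+ p) g); apply: po_addr_ge0 => //; last exact: po_mulrn_ge0.
by move: gk; rewrite kp mulrNz -pmulrn.
Qed.

Lemma div_rel_lb : exists k, div_rel (u *+ k) 1.
Proof. by exists 0%N, 0, 1%N; rewrite mul0r mulr0z !addr0. Qed.

Lemma div_rel_ub : order_unit u -> exists k, div_rel (u *+ k) (-1).
Proof.
(* Since [-1 = (-1) * m + (m - 1)], only [a <= u *+ k] has to hold. *)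
move=> /(_ a)[k _ ak]; exists k, (-1), m.-1; split; first by lia.
by rewrite mulrN1z; apply/po_subr_ge0.
Qed.

Definition div_type (hu : order_unit u) : one_type u :=
  OneType div_relD div_rel0 div_rel_lb (div_rel_ub hu).

End DivisionType.

(** * The one-type of an interpolant *)

(** Of the [c] copies, [K * k] are grouped into [k] blocks that each gain one [u]; the others only
    need [x <= y]. *)
Lemma scaled_gap (G : porderZmodType) (poG : po_abgroup G) (u x y : G) (K k c : nat) :
    x <= y -> x *+ K + u <= y *+ K -> (K * k <= c)%N ->
  x *+ c + u *+ k <= y *+ c.
Proof.
move=> xy gap Kk; rewrite -(subnKC Kk) !mulrnDr addrAC !mulrnA -mulrnDl.
by apply: po_lerD => //; apply: po_lerMn2r.
Qed.

(* One of the three coefficients is at least [K k], and the gap it scales absorbs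
   all of [u *+ k]. *)
Lemma scaled_gap3 (G : porderZmodType) (poG : po_abgroup G) (u x y x' y' x'' y'' : G)
    (K k c c' c'' : nat) :
    x <= y -> x' <= y' -> x'' <= y'' ->
    x *+ K + u <= y *+ K -> x' *+ K + u <= y' *+ K -> x'' *+ K + u <= y'' *+ K ->
    (3 * (K * k) <= c + c' + c'')%N ->
  x *+ c + x' *+ c' + x'' *+ c'' + u *+ k <= y *+ c + y' *+ c' + y'' *+ c''.
Proof.
move=> xy xy' xy'' gap gap' gap'' le_c.
have [Kc|cK] := leqP (K * k)%N c.
  rewrite addrAC (addrAC (x *+ c)).
  by do 2?apply: (po_lerD poG); [apply: scaled_gap gap Kc | apply: po_lerMn2r..].
have [Kc'|cK'] := leqP (K * k)%N c'.
  rewrite addrAC -(addrA (x *+ c)).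
  do 2?apply: (po_lerD poG); [exact: po_lerMn2r | | exact: po_lerMn2r].
  exact: scaled_gap gap' Kc'.
rewrite -addrA; do 2?apply: (po_lerD poG); [exact: po_lerMn2r..|].
by apply: scaled_gap gap'' _ => //; lia.
Qed.

(* The pairing of the lower with the upper terms uses [q0] times [(x0, y0)],
   [p0 - q0] times [(x0, y1)] and [p1] times [(x1, y1)]. *)
Lemma scaled_gap22 (G : porderZmodType) (poG : po_abgroup G) (u x0 x1 y0 y1 : G)
    (K k p0 p1 q0 q1 : nat) :
    x0 <= y0 -> x0 <= y1 -> x1 <= y1 ->
    x0 *+ K + u <= y0 *+ K -> x0 *+ K + u <= y1 *+ K -> x1 *+ K + u <= y1 *+ K ->
    (q0 <= p0)%N -> (p0 + p1 = q0 + q1)%N -> (3 * (K * k) <= p0 + p1)%N ->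
  x0 *+ p0 + x1 *+ p1 + u *+ k <= y0 *+ q0 + y1 *+ q1.
Proof.
move=> le00 le01 le11 gap00 gap01 gap11 qp epq le_k.
have -> : q1 = (p0 - q0 + p1)%N by lia.
rewrite -{1}(subnKC qp) !mulrnDr (addrA (y0 *+ _)).
by apply: scaled_gap3 => //; clear -epq qp le_k; lia.
Qed.

Section InterpolationType.
Variables (G : porderZmodType) (u x0 x1 y0 y1 : G) (K : nat).
Hypothesis poG : po_abgroup G.
Hypotheses (le00 : x0 <= y0) (le01 : x0 <= y1) (le10 : x1 <= y0) (le11 : x1 <= y1).
Hypotheses (lt00 : x0 *+ K + u <= y0 *+ K) (lt01 : x0 *+ K + u <= y1 *+ K).
Hypotheses (lt10 : x1 *+ K + u <= y0 *+ K) (lt11 : x1 *+ K + u <= y1 *+ K).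

(* [g + n z] is bounded below by [p0 (z - x0) + p1 (z - x1) + q0 (y0 - z) +
   q1 (y1 - z) - k u].  With [n = 0] at least [3 K k] differences [y_j - x_i]
   remain, which pay for [k u]; hence the factor 6. *)
Definition interp_rel (g : G) (n : int) :=
  exists p0 p1 q0 q1 k : nat,
    [/\ n = (p0 + p1)%:Z - (q0 + q1)%:Z, (6 * K * k <= (p0 + p1) + (q0 + q1))%N
      & y0 *+ q0 + y1 *+ q1 <= g + (x0 *+ p0 + x1 *+ p1) + u *+ k].

Lemma interp_relD g h n n' :
  interp_rel g n -> interp_rel h n' -> interp_rel (g + h) (n + n').
Proof.
move=> [p0 [p1 [q0 [q1 [k [-> kK le_g]]]]]] [p0' [p1' [q0' [q1' [k' [-> kK' le_h]]]]]].
exists (p0 + p0')%N, (p1 + p1')%N, (q0 + q0')%N, (q1 + q1')%N, (k + k')%N.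
split; [clear; lia | clear -kK kK'; lia |].
rewrite !mulrnDr (addrACA (y0 *+ _)) (addrACA (x0 *+ _)) (addrACA g) (addrACA (g + _)).
exact: po_lerD.
Qed.

Lemma interp_rel0 g : interp_rel g 0 <-> 0 <= g.
Proof.
split=> [[p0 [p1 [q0 [q1 [k [e0 kK le_g]]]]]]|g0]; last first.
  by exists 0%N, 0%N, 0%N, 0%N, 0%N; split; rewrite ?muln0 // !mulr0n !addr0.
suff le_k : x0 *+ p0 + x1 *+ p1 + u *+ k <= y0 *+ q0 + y1 *+ q1.
  have /(po_subr_ge0 poG) := le_trans le_k le_g.
  by rewrite -(addrA g) addrK.
(* If [p0 < q0], the equal totals give [q1 <= p1], and exchanging both pairs of indices restores the
   pairing. *)
have [qp|/ltnW pq] := leqP q0 p0.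
  by apply: (@scaled_gap22 _ poG _ _ _ _ _ K) => //; clear -e0 kK; lia.
rewrite (addrC (x0 *+ _)) (addrC (y0 *+ _)).
by apply: (@scaled_gap22 _ poG _ _ _ _ _ K) => //; clear -e0 kK pq; lia.
Qed.

Lemma interp_rel_lb : order_unit u -> exists k, interp_rel (u *+ k) 1.
Proof.
(* The single generator [z - x0] suffices, as [- x0] is below a multiple of [u]. *)
move=> /(_ (- x0))[k _ xk]; exists k, 1%N, 0%N, 0%N, 0%N, 0%N.
split; [clear; lia | clear; lia | rewrite !mulr0n !addr0 mulr1n].
by rewrite -[x0]opprK; apply/po_subr_ge0.
Qed.

Lemma interp_rel_ub : order_unit u -> exists k, interp_rel (u *+ k) (-1).
Proof.
move=> /(_ y0)[k _ yk]; exists k, 0%N, 0%N, 1%N, 0%N, 0%N.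
by split; [clear; lia | clear; lia | rewrite !mulr0n !addr0 mulr1n].
Qed.

Definition interp_type (hu : order_unit u) : one_type u :=
  OneType interp_relD interp_rel0 (interp_rel_lb hu) (interp_rel_ub hu).

End InterpolationType.

(** * One step of the construction *)

Lemma po_embedding_le (G H : porderZmodType) (f : {additive G -> H}) :
  po_abgroup G -> po_abgroup H -> po_embedding f -> forall x y, x <= y <-> f x <= f y.
Proof.
move=> poG poH [_ f_ge0] x y; rewrite -(po_subr_ge0 poG) -(po_subr_ge0 poH) -raddfB.
exact: f_ge0.
Qed.

(** The solutions lie in the larger group [H], whose own problems are not addressed; hence the later
    iteration. *)
Lemma interpolate_divide (G : porderZmodType) : simple_po_abgroup G ->
  exists (H : porderZmodType) (f : {additive G -> H}),
    [/\ simple_po_abgroup H, po_embedding f,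
      forall x0 x1 y0 y1 : G, x0 <= y0 -> x0 <= y1 -> x1 <= y0 -> x1 <= y1 ->
        exists z : H, [/\ f x0 <= z, f x1 <= z, z <= f y0 & z <= f y1]
    & forall (a : G) m, 0 <= a -> (0 < m)%N -> exists2 x : H, 0 <= x & x *+ m = f a].
Proof.
move=> simG; have [poG dirG unitG] := simG.
have [[u [u_ge0 u_neq0]]|no_unit] := pselect (exists u : G, 0 <= u /\ u <> 0); last first.
  (* Without a nonzero positive element, directedness makes [G] trivial. *)
  have G0 (x : G) : x = 0.
    have pos0 (y : G) : 0 <= y -> y = 0.
      by move=> y0; apply: contrapT => ny; apply: no_unit; exists y.
    by have [a [b [/pos0-> /pos0-> ->]]] := dirG x; rewrite subrr.
  exists G, idfun; split=> //.
    by move=> x0 x1 y0 y1 _ _ _ _; exists 0; rewrite (G0 x0) (G0 x1) (G0 y0) (G0 y1).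
  by move=> a m _ _; exists 0; rewrite // (G0 a) mul0rn.
have unit_u := unitG u u_ge0 u_neq0.
have [H [f [simH f_emb real_f]]] := realize_types simG u_ge0 u_neq0.
have [poH _ _] := simH.
have f_le := po_embedding_le poG poH f_emb.
exists H, f; split=> // [x0 x1 y0 y1 le00 le01 le10 le11|a m a_ge0 m_gt0]; last first.
  have [->|/eqP a_neq0] := eqVneq a 0; first by exists 0; rewrite // mul0rn raddf0.
  have [x [x_ge0 x_eq0]] := real_f (div_type poG a_ge0 m_gt0 unit_u).
  exists x.
    suff: 0 <= f 0 + x *~ 1 by rewrite raddf0 add0r.
    apply: x_ge0.
      by exists 0, 1%N; rewrite mul0r mulr0z !addr0.
    (* With the new element in the role of [a/m], [m * K] copies of it amount to [K] copies of [a],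
       which exceed [u]. *)
    have [K _ uK] := unitG a a_ge0 a_neq0 u; exists (m * K)%N, K%:Z, 0%N.
    by split; [clear; lia | rewrite mul0rn sub0r addrC; apply/po_subr_ge0].
  (* The relation for [m x - a] and the one for its negative both hold in the one-type, so this
     difference is null. *)
  apply/subr0_eq; rewrite addrC -raddfN; apply: (x_eq0 (- a) m%:Z).
    by exists 1, 0%N; split; [clear; lia | rewrite mulr1z addNr].
  by exists (-1), 0%N; split; [clear; lia | rewrite mulrN1z opprK subrr].
have gap x y : x <= y -> x <> y -> exists K, u <= (y - x) *+ K.
  move=> xy nxy; have d0 : 0 <= y - x by apply/po_subr_ge0.
  by have [|K _ uK] := unitG _ d0 _ u; [move=> /subr0_eq/esym | exists K].
(* A common value of a lower and an upper bound is itself an interpolant. Otherwise all four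
   differences are order-units. *)
have [e00|n00] := pselect (x0 = y0).
  by exists (f x0); split; rewrite -?f_le // ?e00.
have [e01|n01] := pselect (x0 = y1).
  by exists (f x0); split; rewrite -?f_le // ?e01.
have [e10|n10] := pselect (x1 = y0).
  by exists (f x1); split; rewrite -?f_le // ?e10.
have [e11|n11] := pselect (x1 = y1).
  by exists (f x1); split; rewrite -?f_le // ?e11.
have [[K00 gap00] [K01 gap01]] := (gap _ _ le00 n00, gap _ _ le01 n01).
have [[K10 gap10] [K11 gap11]] := (gap _ _ le10 n10, gap _ _ le11 n11).
(* One scale valid for all four gaps. *)
pose K := (K00 + K01 + K10 + K11)%N.
have gapK x y K' : x <= y -> u <= (y - x) *+ K' -> (K' <= K)%N -> x *+ K + u <= y *+ K.
  move=> /(po_subr_ge0 poG) xy uK' /(po_lerMn2l poG xy)/(le_trans uK').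
  by rewrite mulrnBl => /(po_lerD poG (lexx (x *+ K))); rewrite [x *+ K + (_ - _)]addrC subrK.
have lt00 : x0 *+ K + u <= y0 *+ K by apply: gapK gap00 _ => //; rewrite /K -!addnA leq_addr.
have lt01 : x0 *+ K + u <= y1 *+ K by apply: gapK gap01 _ => //; clear; lia.
have lt10 : x1 *+ K + u <= y0 *+ K by apply: gapK gap10 _ => //; clear; lia.
have lt11 : x1 *+ K + u <= y1 *+ K by apply: gapK gap11 _ => //; rewrite /K leq_addl.
clearbody K.
have [z [z_ge0 _]] :=
  real_f (interp_type poG le00 le01 le10 le11 lt00 lt01 lt10 lt11 unit_u).
exists z; split; apply/(po_subr_ge0 poH).
- rewrite addrC -raddfN -[z]mulr1z; apply: z_ge0; first exists 1%N, 0%N, 0%N, 0%N, 0%N.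
    by split; [clear; lia | clear; lia | rewrite !mulr0n !addr0 addNr].
  (* With [6 * K] copies of the generator, the inequality in [interp_rel] permits [k = 1], that is,
     subtracting one [u]. The other three bounds go the same way. *)
  exists (6 * K)%N, (6 * K)%N, 0%N, 0%N, 0%N, 1%N.
  by split; [clear; lia | clear; lia | rewrite !mulr0n mulr1n !addr0 mulNrn addrAC subrK addNr].
- rewrite addrC -raddfN -[z]mulr1z; apply: z_ge0; first exists 0%N, 1%N, 0%N, 0%N, 0%N.
    by split; [clear; lia | clear; lia | rewrite !mulr0n !addr0 add0r addNr].
  exists (6 * K)%N, 0%N, (6 * K)%N, 0%N, 0%N, 1%N.
  by split; [clear; lia | clear; lia | rewrite !mulr0n mulr1n !addr0 add0r mulNrn addrAC subrK addNr].
- rewrite -mulrN1z; apply: z_ge0; first exists 0%N, 0%N, 1%N, 0%N, 0%N.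
    by split; [clear; lia | clear; lia | rewrite !mulr0n !addr0].
  exists (6 * K)%N, 0%N, 0%N, (6 * K)%N, 0%N, 1%N.
  by split; [clear; lia | clear; lia | rewrite !mulr0n mulr1n !addr0 subrK].
- rewrite -mulrN1z; apply: z_ge0; first exists 0%N, 0%N, 0%N, 1%N, 0%N.
    by split; [clear; lia | clear; lia | rewrite !mulr0n !addr0 add0r].
  exists (6 * K)%N, 0%N, 0%N, 0%N, (6 * K)%N, 1%N.
  by split; [clear; lia | clear; lia | rewrite !mulr0n mulr1n !addr0 add0r subrK].
Qed.

(** * Sequential colimits *)

Section DependentProduct.
Variable D : nat -> zmodType.

Definition dprod := forall n, D n.

HB.instance Definition _ := Choice.copy dprod (forall n, D n).

Definition dprod_add (v w : dprod) : dprod := fun n => v n + w n.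
Definition dprod_opp (v : dprod) : dprod := fun n => - v n.
Definition dprod_zero : dprod := fun=> 0.

Lemma dprod_addA : associative dprod_add.
Proof. by move=> u v w; apply: functional_extensionality_dep => n; apply: addrA. Qed.

Lemma dprod_addC : commutative dprod_add.
Proof. by move=> u v; apply: functional_extensionality_dep => n; apply: addrC. Qed.

Lemma dprod_add0 : left_id dprod_zero dprod_add.
Proof. by move=> u; apply: functional_extensionality_dep => n; apply: add0r. Qed.

Lemma dprod_addN : left_inverse dprod_zero dprod_opp dprod_add.
Proof. by move=> u; apply: functional_extensionality_dep => n; apply: addNr. Qed.

HB.instance Definition _ :=
  GRing.isZmodule.Build dprod dprod_addA dprod_addC dprod_add0 dprod_addN.

End DependentProduct.

(** Sequences that follow the maps from some [N] on will represent the elements of the colimit. *)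
Definition coherent_from (D : nat -> zmodType) (f : forall n, D n -> D n.+1)
    (N : nat) (v : dprod D) :=
  forall n, (N <= n)%N -> f n (v n) = v n.+1.

(** Induction on [n] shifts the system by one stage; the entries before [n] are 0 and those after it
    iterate [f]. *)
Lemma coherent_extension (D : nat -> zmodType) (f : forall n, D n -> D n.+1) n (x : D n) :
  exists v : dprod D, v n = x /\ coherent_from f n v.
Proof.
elim: n D f x => [|n IHn] D f x; last first.
  have [v [vn vf]] := IHn (fun k => D k.+1) (fun k => f k.+1) x.
  exists (fun k => if k is k'.+1 then v k' else 0); split=> // -[//|k] lt_nk.
  exact: vf.
by exists (nat_rect D x f); split.
Qed.

(** The cone of eventually nonnegative sequences makes the quotient identify coherent sequences that
    eventually agree. As the maps are embeddings, the sign can be read at any stage from which the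
    sequence is coherent. *)
Lemma sequential_colimit (D : nat -> porderZmodType)
    (f : forall n, {additive D n -> D n.+1}) :
    (forall n, po_abgroup (D n)) -> (forall n, po_embedding (f n)) ->
  exists (H : porderZmodType) (g : forall n, {additive D n -> H}),
    [/\ po_abgroup H, forall n x, g n.+1 (f n x) = g n x,
        forall n, po_embedding (g n) & forall h, exists n (x : D n), h = g n x].
Proof.
move=> poD f_emb; pose V : zmodType := dprod D.
pose coh N (v : V) := coherent_from f N v.
have cohW M N v : (M <= N)%N -> coh M v -> coh N v.
  by move=> MN cv n Nn; apply: cv; apply: leq_trans Nn.
have cohB N v w : coh N v -> coh N w -> coh N (v - w).
  move=> cv cw n Nn; rewrite -[(v - w) n]/(v n - w n) raddfB cv // cw //.
pose dm (v : V) := exists N, coh N v.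
pose cn (v : V) := exists N, forall n, (N <= n)%N -> 0 <= v n.
have dm0 : dm 0 by exists 0%N => n _; rewrite -[LHS]/(f n 0) raddf0.
have dmB v w : dm v -> dm w -> dm (v - w).
  move=> [M cv] [N cw]; exists (maxn M N).
  by apply: cohB; [apply: cohW cv | apply: cohW cw]; lia.
have cn0 : cn 0 by exists 0%N.
have cnD v w : cn v -> cn w -> cn (v + w).
  move=> [M v0] [N w0]; exists (maxn M N) => n Nn.
  by apply: (po_addr_ge0 (poD n)); [apply: v0 | apply: w0]; lia.
pose K := Precone dm0 dmB cn0 cnD.
have coh_ge0 N v j : coh N v -> (0 <= v N <-> 0 <= v (N + j)%N).
  move=> cv; elim: j => [|j IHj]; first by rewrite addn0.
  have [_ f_ge0] := f_emb (N + j)%N.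
  by rewrite addnS -cv ?leq_addr // -f_ge0.
have cnP N v : coh N v -> (cn v <-> 0 <= v N).
  move=> cv; split=> [[M v0]|v0].
    by apply/(coh_ge0 N v M cv)/v0; lia.
  by exists N => n Nn; rewrite -(subnKC Nn); apply: (proj1 (coh_ge0 _ _ _ cv)).
have eq_pi N v w : coh N v -> coh N w -> v N = w N -> cone_pi K v = cone_pi K w.
  move=> cv cw vw; apply: eq_cone_pi; first by exists N.
  split; first by exists N.
    apply/(cnP _ _ (cohB _ _ _ cv cw)).
    by rewrite -[(v - w) N]/(v N - w N) vw subrr.
  apply/(cnP _ _ (cohB _ _ _ cw cv)).
  by rewrite -[(w - v) N]/(w N - v N) vw subrr.
(* The coherent extension is arbitrary; by [eq_pi] its class depends only on [x]. *)
pose ext n (x : D n) : V := sval (cid (coherent_extension f x)).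
have ext_at n (x : D n) : ext n x n = x by rewrite /ext; case: cid => v [].
have ext_coh n (x : D n) : coh n (ext n x) by rewrite /ext; case: cid => v [].
have gB n x y : cone_pi K (ext n (x - y)) = cone_pi K (ext n x) - cone_pi K (ext n y).
  rewrite -cone_piB; [|by exists n..]; apply: (eq_pi n) => //; first exact: cohB.
  by rewrite -[(ext n x - _) n]/(ext n x n - ext n y n) !ext_at.
pose g n : {additive D n -> cone_quot K} := additive_of (gB n).
have g_ge0 n x : 0 <= x <-> 0 <= g n x.
  rewrite -{1}(ext_at n x) -(cnP _ _ (ext_coh n x)) -[0 in X in _ <-> X]/(cone_pi K 0).
  by rewrite cone_pi_le ?subr0 //; exists n.
exists (cone_quot K), g; split=> [|n x|n|h].
- exact: cone_quot_po.
- apply: (eq_pi n.+1); [exact: ext_coh|by apply: cohW (ext_coh n x)|].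
  by rewrite ext_at -(ext_coh n x) // ext_at.
- split=> // x y gxy; apply/subr0_eq/(po_ge0_anti (poD n)); apply/g_ge0.
    by rewrite raddfB gxy subrr.
  by rewrite opprB raddfB gxy subrr.
have [n cn_h] := dom_val h; exists n, (val h n); rewrite -[LHS]cone_piK.
by apply: (eq_pi n).
Qed.

(** * Iteration and passage to the limit *)

Theorem corollary2p8 (G : porderZmodType) (hG : simple_po_abgroup G) :
  exists (H : porderZmodType) (f : {additive G -> H}),
    [/\ simple_po_abgroup H, riesz_group H, divisible_positive_cone H
      & po_embedding f].
Proof.
pose stage := {K : porderZmodType | simple_po_abgroup K}.
pose good (S T : stage) (f : {additive sval S -> sval T}) :=
  [/\ po_embedding f,
    forall x0 x1 y0 y1, x0 <= y0 -> x0 <= y1 -> x1 <= y0 -> x1 <= y1 ->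
      exists z, [/\ f x0 <= z, f x1 <= z, z <= f y0 & z <= f y1]
  & forall a m, 0 <= a -> (0 < m)%N -> exists2 x, 0 <= x & x *+ m = f a].
have /choice[next nextP] (S : stage) : exists (T : stage), exists f, @good S T f.
  have [T [f [simT emb_f interp_f div_f]]] := interpolate_divide (svalP S).
  by exists (exist _ T simT), f; split.
pose D n : stage := iter n next (exist _ G hG).
pose DT n : porderZmodType := sval (D n).
pose f n : {additive DT n -> DT n.+1} := sval (cid (nextP (D n))).
have f_spec n : @good (D n) (D n.+1) (f n) by apply: svalP.
have simD n : simple_po_abgroup (DT n) by apply: svalP.
have poD n : po_abgroup (DT n) by have [] := simD n.
have f_emb n : po_embedding (f n) by have [] := f_spec n.
have [H [g [poH gf g_emb g_surj]]] := sequential_colimit poD f_emb.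
have g_le n (x y : DT n) : (x <= y) = (g n x <= g n y).
  by apply/idP/idP; apply (po_embedding_le (poD n) poH (g_emb n)).
have g_ge0 n (x : DT n) : (0 <= x) = (0 <= g n x).
  by rewrite g_le raddf0.
(* Every element comes from all late stages, so finitely many elements can be pulled back to a
   common one. *)
have raise h : exists n, forall m, (n <= m)%N -> exists x : DT m, h = g m x.
  have [n [x ->]] := g_surj h; exists n => m /subnKC <-.
  elim: (m - n)%N => [|j [y ->]]; first by rewrite addn0; exists x.
  by rewrite addnS; exists (f _ y); rewrite gf.
have dirH : directed H.
  move=> h; have [n [x ->]] := g_surj h; have [_ dirn _] := simD n.
  have [a [b [a0 b0 ->]]] := dirn x.
  by exists (g n a), (g n b); rewrite -!g_ge0 raddfB.
exists H, (g 0%N); split=> //.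
- split=> // u u0 u_neq0 h.
  have [[m mP] [n nP]] := (raise u, raise h).
  have [[v uv] [x hx]] := (mP _ (leq_maxl m n), nP _ (leq_maxr m n)).
  have [_ _ /(_ v)unit_v] := simD (maxn m n).
  have [||k k_gt0 xk] := unit_v _ _ x.
  + by rewrite g_ge0 -uv.
  + by move=> v0; apply: u_neq0; rewrite uv v0 raddf0.
  by exists k; rewrite // uv hx -raddfMn -g_le.
- split=> // x0 x1 y0 y1.
  have [[m0 x0P] [m1 x1P]] := (raise x0, raise x1).
  have [[n0 y0P] [n1 y1P]] := (raise y0, raise y1).
  pose N := (m0 + m1 + n0 + n1)%N.
  have [|a0 ->] := x0P N; first by lia.
  have [|a1 ->] := x1P N; first by lia.
  have [|b0 ->] := y0P N; first by lia.
  have [|b1 ->] := y1P N; first by lia.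
  rewrite -!g_le => le00 le01 le10 le11; have [_ interp _] := f_spec N.
  have [z [? ? ? ?]] := interp _ _ _ _ le00 le01 le10 le11.
  (* The interpolant appears one stage later, and [gf] carries the bounds there without changing
     their images. *)
  by exists (g N.+1 z); rewrite -!(gf N) -!g_le.
- move=> a m a_ge0 m_gt0; have [n [b eb]] := g_surj a.
  have [_ _ divn] := f_spec n; rewrite eb -g_ge0 in a_ge0 *.
  have [x x0 xm] := divn b m a_ge0 m_gt0.
  by exists (g n.+1 x); rewrite -?g_ge0 // -raddfMn xm gf.
exact (g_emb 0%N).
Qed.
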